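(* Let $P$ be a set of prime numbers such that $\sum_{p \notin P} 1/p < \infty$, where the sum runs over all primes not belonging to $P$. Let $\alpha \in \mathbb{R}\setminus\mathbb{Z}$ with $\alpha>1$, and let $G = P \cup \{\alpha\}$. Let $b_0=1\le b_1 \le b_2 \le \dots$ be the Beurling integers generated by $G$. Then \[ \liminf_{i\to\infty} (b_{i+1}-b_i) = 0. \]
   Context: For a sequence $G=\{g_1,g_2,\dots\}$ of real numbers with $1<g_1\le g_2\le\dots$ (the generators), the associated Beurling integers are the sequence $B=\{b_0,b_1,b_2,\dots\}$, $b_0=1\le b_1\le b_2\le\dots$, consisting of all finite products of elements of $G$ (repetitions of factors allowed, the empty product being $1$), listed in nondecreasing order with multiplicity. *)

(* Defs.v *)
From HB Require Import structures.
From mathcomp Require Export all_boot all_order all_algebra finmap.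
From mathcomp Require Export all_classical all_reals all_analysis.
Export Order.TTheory GRing.Theory Num.Theory.
Export numFieldNormedType.Exports.

Set Implicit Arguments.
Unset Strict Implicit.
Unset Printing Implicit Defensive.

Local Open Scope classical_set_scope.
Local Open Scope ring_scope.

(* A set of generators, as opposed to a sequence, contributes each of its
   elements once, in increasing order. *)
Definition enumerates (R : realType) (g : nat -> R) (G : set R) : Prop :=
  nondecreasing_seq g /\ set_bij [set: nat] G g.

(* A finite product of generators with repetitions is given by the finitely
   supported exponents of the terms of g; the zero exponent gives 1. *)
Definition beurling_prod (R : realType) (g : nat -> R)
    (e : {fsfun nat -> nat with 0%N}) : R :=
  \prod_(n <- finsupp e) g n ^+ e n.

(* The multiplicity of a value in b is the number of exponents giving it, so
   equal products with different exponents are listed separately; b 0 = 1 is a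
   consequence when all the generators exceed 1. *)
Definition beurling_integers (R : realType) (g b : nat -> R) : Prop :=
  nondecreasing_seq b /\
  exists2 e : nat -> {fsfun nat -> nat with 0%N},
    bijective e & forall i, b i = beurling_prod g (e i).

(* Main.v *)
Require Import Defs.
From mathcomp Require Import zify ring lra.

(** Let Q be the set of primes outside P.  It suffices to find, for every
    eps > 0, arbitrarily large Q-free integers x, y and some k >= 1 with
    |x - alpha^k y| < eps: such x and alpha^k y are Beurling integers of distinct
    indices, because the exponents of alpha differ.

    Fix z large, D = z!, and look for x and y congruent to 1 modulo D, which
    disposes of the primes of Q up to z.
    If alpha = a/b in lowest terms, take k with D < eps b^k and let h be the
    remainder of a^k - b^k modulo D; the solutions of a^k y - b^k x = h contain
    a pair of arithmetic progressions with common differences prime to every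
    q > z.
    If alpha is irrational, take k = 1; the pairs with 0 <= alpha y - x < eps
    have density at least c ~ eps / D, and comparing with translates by small
    values of a - alpha r with q | a, r shows that those with q | x or q | y have
    density at most C c / q, with C independent of z.
    In both cases the sum of 1/q over q in Q, q > z, is at most 1 / (8 C), so the
    primes of Q below a bound Z destroy only a fraction of the pairs; those
    above Z are handled by the trivial bound, Z being chosen after z and c. *)

Local Open Scope classical_set_scope.
Local Open Scope ring_scope.

Definition cnt (S : pred nat) (n : nat) : nat := (\sum_(t < n) S t)%N.

Lemma cnt_homo (S : pred nat) (m n : nat) : (m <= n)%N -> (cnt S m <= cnt S n)%N.
Proof.
move=> mn; rewrite /cnt -!(big_mkord xpredT (fun t => nat_of_bool (S t))).
by rewrite (@big_cat_nat _ _ _ m 0 n)//= leq_addr.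
Qed.

Lemma cnt_subadd (S T U : pred nat) (n : nat) :
  (forall t, S t -> T t || U t) -> (cnt S n <= cnt T n + cnt U n)%N.
Proof.
move=> STU; rewrite /cnt -big_split; apply: leq_sum => t _ /=.
by have := STU t; case: (S t) => // /(_ isT); case: (T t); case: (U t).
Qed.

Lemma cnt_card (S : pred nat) (n : nat) : cnt S n = #|[set t : 'I_n | S t]%SET|.
Proof.
rewrite cardsE -sum1_card big_mkcond; apply: eq_bigr => t _.
by rewrite unfold_in; case: (S t).
Qed.

Lemma card_leq_inj (I : finType) (A : {set I}) (f : I -> nat) (N : nat) :
  {in A &, injective f} -> (forall i, i \in A -> (f i < N)%N) -> (#|A| <= N)%N.
Proof.
case: N => [|N] injf fN.
  by rewrite leqn0 cards_eq0; apply/eqP/setP => i; rewrite inE; apply/negP => /fN.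
rewrite -[leqRHS]card_ord -cardsT.
have injh : {in A &, injective (fun i => inord (f i) : 'I_N.+1)}.
  by move=> i j iA jA /(congr1 val); rewrite /= !inordK ?fN//; exact: injf.
by rewrite -(card_in_imset injh) subset_leq_card// subsetT.
Qed.

Lemma cnt_packing (S : pred nat) (n q K s N : nat) (v : nat -> nat) :
  (forall t, (t < n)%N -> S t -> (v t + q + K * s <= N)%N) ->
  (forall t t' i i' j j', (t < n)%N -> (t' < n)%N -> S t -> S t' ->
     (i < q)%N -> (i' < q)%N -> (j < K)%N -> (j' < K)%N ->
     (v t + i + j * s = v t' + i' + j' * s)%N -> [/\ t = t', i = i' & j = j']) ->
  (cnt S n * (q * K) <= N)%N.
Proof.
move=> vN vinj.
pose A : {set 'I_n * ('I_q * 'I_K)} :=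
  finset.setX [set t : 'I_n | S t]%SET [set: 'I_q * 'I_K]%SET.
have -> : (cnt S n * (q * K))%N = #|A|.
  by rewrite cardsX -cnt_card cardsT card_prod !card_ord.
apply: (@card_leq_inj _ _ (fun p : 'I_n * ('I_q * 'I_K) => v p.1 + p.2.1 + p.2.2 * s)%N).
  move=> [t [i j]] [t' [i' j']]; rewrite !inE/= !andbT => St St' /vinj.
  by case=> // /val_inj -> /val_inj -> /val_inj ->.
move=> [t [i j]]; rewrite !inE/= andbT => St.
apply: leq_trans (vN t (ltn_ord t) St).
have := ltn_ord i; have : (j * s <= K * s)%N by rewrite leq_mul2r ltnW ?orbT.
lia.
Qed.

Lemma cnt_covering (S : pred nat) (n L r : nat) :
  (forall t, exists2 j, (j < L)%N & S (t + j * r)%N) ->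
  (n <= L * cnt S (n + L * r))%N.
Proof.
move=> cov.
apply: (@leq_trans (\sum_(t < n) \sum_(j < L) S (t + j * r)))%N.
  rewrite -[leqLHS]card_ord -sum1_card; apply: leq_sum => t _.
  have [j jL Stj] := cov t; rewrite (bigD1 (Ordinal jL))//= Stj; lia.
rewrite exchange_big/=.
apply: (@leq_trans (\sum_(j < L) cnt S (n + L * r)))%N; last first.
  by rewrite sum_nat_const card_ord.
apply: leq_sum => j _.
apply: (@leq_trans (cnt S (n + j * r)))%N; last first.
  by apply: cnt_homo; rewrite leq_add2l leq_mul2r ltnW ?orbT.
have -> : (\sum_(t < n) S (t + j * r) = \sum_(0 + j * r <= t < n + j * r) S t)%N.
  by rewrite big_addn addnK big_mkord.
rewrite add0n /cnt -(big_mkord xpredT (fun t => nat_of_bool (S t))).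
by rewrite (@big_cat_nat _ _ _ (j * r)%N 0) ?leq_addl//= leq_addl.
Qed.

Lemma eqn_mod_rem (q a a' i i' : nat) :
  a = a' %[mod q] -> (i < q)%N -> (i' < q)%N -> (a + i = a' + i')%N -> i = i'.
Proof.
move=> aa' iq i'q /(congr1 (modn^~ q))/eqP.
by rewrite /= -modnDml aa' modnDml eqn_modDl !modn_small// => /eqP.
Qed.

Section sieve.
Variables (R : realType) (Q S : pred nat).
Hypothesis Q_gt0 : forall q, Q q -> (0 < q)%N.
Hypothesis tailQ : forall d : R, 0 < d ->
  \forall Z \near \oo, forall Y, \sum_(Z <= q < Y | Q q) q%:R^-1 <= d.

Lemma cnt_dvdn (x : nat -> nat) (A q n : nat) :
  (0 < q)%N ->
  (forall t t', S t -> S t' -> x t = x t' -> t = t') ->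
  (forall t, S t -> (0 < x t <= A * t.+1)%N) ->
  (cnt (fun t => S t && (q %| x t)%N) n)%:R <= (A * n)%:R / q%:R :> R.
Proof.
move=> q0 xinj xA; rewrite ler_pdivlMr ?ltr0n// -natrM ler_nat.
have qx t : S t -> (q %| x t)%N -> (q <= x t)%N.
  by move=> St qxt; apply: dvdn_leq qxt; case/andP: (xA t St).
have := @cnt_packing (fun t => S t && (q %| x t)%N) n q 1 0 (A * n) (fun t => x t - q)%N.
rewrite muln1; apply.
  move=> t tn /andP[St qxt]; rewrite muln0 addn0 (subnK (qx t St qxt)).
  have /andP[_ /leq_trans] := xA t St; apply.
  by rewrite leq_mul2l tn orbT.
move=> t t' i i' j j' _ _ /andP[St qxt] /andP[St' qxt'] iq iq'.
rewrite !ltnS !leqn0 => /eqP-> /eqP->; rewrite !addn0 => E.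
have ii' : i = i'.
  apply: eqn_mod_rem iq iq' E.
  by rewrite !(eqP (dvdn_sub _ _)) ?dvdnn.
split => //; apply: xinj => //; have := qx _ St qxt; have := qx _ St' qxt'; lia.
Qed.

Definition sievable (x : nat -> nat) (z A : nat) (c C : R) : Prop :=
  [/\ forall t t', S t -> S t' -> x t = x t' -> t = t',
      forall t, S t -> (0 < x t <= A * t.+1)%N,
      forall t q, S t -> Q q -> (q < z)%N -> ~~ (q %| x t)%N &
      forall q, Q q -> (z <= q)%N -> \forall n \near \oo,
        (cnt (fun t => S t && (q %| x t)%N) n)%:R <= C * c / q%:R * n%:R].

Variables (z A : nat) (c C : R).
Hypothesis c_gt0 : 0 < c.
Hypothesis hz : forall Y, C * \sum_(z <= q < Y | Q q) q%:R^-1 <= 8^-1.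

(* The finitely many q in [z, Z) are handled by the density of each class and
   the q >= Z by the trivial bound A n / q, where Z depends on c and A. *)
Lemma sieve_cnt (x : nat -> nat) : sievable x z A c C -> \forall n \near \oo,
  (cnt (fun t => S t && has Q (divisors (x t))) n)%:R <= c / 4 * n%:R.
Proof.
move=> [x_inj x_bound x_small x_mid].
have [Z [zZ tailZ]] : exists Z, (z <= Z)%N /\
    forall Y, \sum_(Z <= q < Y | Q q) q%:R^-1 <= c / (8 * A.+1%:R).
  have d0 : 0 < c / (8 * A.+1%:R) by rewrite divr_gt0// mulr_gt0.
  near \oo => Z; exists Z; split; first by near: Z; exact: nbhs_infty_ge.
  by near: Z; exact: tailQ d0.
have mid : \forall n \near \oo, forall q : 'I_Z, Q q -> (z <= q)%N ->
    (cnt (fun t => S t && (q %| x t)%N) n)%:R <= C * c / q%:R * n%:R.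
  apply: filter_forall => q.
  have [Qq|/negP nQq] := boolP (Q q); last by apply: nearW.
  have [zq|/negP nzq] := boolP (z <= q)%N; last by apply: nearW.
  by move: (x_mid q Qq zq); apply: filterS => k kq _ _.
near=> n.
have nZ : (Z <= n)%N by near: n; exact: nbhs_infty_ge.
set Y := (A.+1 * n).+1.
have ZY : (Z <= Y)%N by rewrite /Y mulSn; lia.
set f := fun q => cnt (fun t => S t && (q %| x t)%N) n.
have le_f : (cnt (fun t => S t && has Q (divisors (x t))) n
    <= \sum_(0 <= q < Y | Q q) f q)%N.
  rewrite exchange_big/=; apply: leq_sum => t _.
  have [St/=|//] := boolP (S t).
  have /andP[xt0 xtA] := x_bound _ St.
  have [/hasP[q]|//] := boolP (has _ _); rewrite -dvdn_divisors// => qx Qq.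
  have qY : (q < Y)%N.
    rewrite ltnS (leq_trans (dvdn_leq xt0 qx))// (leq_trans xtA)//.
    by rewrite leq_mul.
  by rewrite big_mkcond (bigD1_seq q) ?mem_index_iota ?iota_uniq//= Qq qx.
apply: le_trans (_ : (\sum_(0 <= q < Y | Q q) f q)%:R <= _); first by rewrite ler_nat.
rewrite natr_sum (@big_cat_nat _ _ _ z 0 Y)//=; last exact: leq_trans ZY.
rewrite big_nat_cond big1 ?add0r; last first.
  move=> q /andP[/andP[_ qz] Qq]; rewrite /f/cnt big1// => t _.
  by have [St/=|//] := boolP (S t); rewrite (negbTE (x_small _ _ St Qq qz)).
rewrite (@big_cat_nat _ _ _ Z z Y)//= (_ : c / 4 = c / 8 + c / 8); last by field.
rewrite mulrDl lerD//.
  apply: le_trans (_ : c * n%:R * (C * \sum_(z <= q < Z | Q q) q%:R^-1) <= _).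
    rewrite !mulr_sumr big_nat_cond [leRHS]big_nat_cond ler_sum// => q.
    move=> /andP[/andP[zq qZ] Qq].
    have mid_n : forall q : 'I_Z, Q q -> (z <= q)%N ->
        (cnt (fun t => S t && (q %| x t)%N) n)%:R <= C * c / q%:R * n%:R.
      by near: n.
    apply: le_trans (mid_n (Ordinal qZ) Qq zq) _.
    by rewrite le_eqVlt; apply/orP; left; apply/eqP; ring.
  by rewrite (mulrAC c 8^-1) ler_wpM2l// mulr_ge0// ltW.
apply: le_trans (_ : (A.+1 * n)%:R * \sum_(Z <= q < Y | Q q) q%:R^-1 <= _).
  rewrite !mulr_sumr ler_sum// => q Qq.
  apply: cnt_dvdn => //; first exact: Q_gt0.
  move=> t St; have /andP[-> /leq_trans->//] := x_bound _ St.
  by rewrite leq_mul2r leqnSn orbT.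
apply: le_trans (ler_wpM2l _ (tailZ Y)) _; first exact: ler0n.
rewrite natrM le_eqVlt; apply/orP; left; apply/eqP; field.
by rewrite nat1r pnatr_eq0.
Unshelve. all: end_near.
Qed.

Hypothesis S_dense : \forall n \near \oo, c * n%:R <= (cnt S n)%:R.

Lemma sieve_pair (x y : nat -> nat) (T : nat) :
  sievable x z A c C -> sievable y z A c C ->
  exists t, [/\ (T <= t)%N, S t, ~~ has Q (divisors (x t)) &
                ~~ has Q (divisors (y t))].
Proof.
move=> sx sy; apply: contrapT => noT.
have : \forall n \near \oo, False.
  near=> n.
  have cx : (cnt (fun t => S t && has Q (divisors (x t))) n)%:R <= c / 4 * n%:R.
    by near: n; exact: sieve_cnt.
  have cy : (cnt (fun t => S t && has Q (divisors (y t))) n)%:R <= c / 4 * n%:R.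
    by near: n; exact: sieve_cnt.
  have cS : c * n%:R <= (cnt S n)%:R by near: n.
  have Tc : T%:R / c * 4 <= n%:R by near: n; exact: nbhs_infty_ger.
  have Tn : (T < n)%N by near: n; exact: nbhs_infty_gt.
  have cT : (cnt (fun t => t < T)%N n <= T)%N.
    rewrite cnt_card -(card_ord n); apply: (@card_leq_inj _ _ (fun t => val t)).
      by move=> ? ? _ _ /val_inj.
    by move=> t; rewrite inE.
  have le_S : (cnt S n <= cnt (fun t => S t && has Q (divisors (x t))) n +
      (cnt (fun t => S t && has Q (divisors (y t))) n + cnt (fun t => t < T)%N n))%N.
    apply: leq_trans (leq_add (leqnn _) (cnt_subadd
      (fun t => (S t && has Q (divisors (y t))) || (t < T)%N) _ _ _ _)) => //.
    apply: cnt_subadd => t St /=; rewrite St /=.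
    have [//|/negP nx] := boolP (has Q (divisors (x t))).
    have [//|/negP ny] := boolP (has Q (divisors (y t))) => /=.
    by rewrite ltnNge; apply/negP => Tt; apply: noT; exists t; split => //; apply/negP.
  have cn0 : 0 < c * n%:R by rewrite mulr_gt0// ltr0n (leq_ltn_trans _ Tn).
  have : T%:R <= c * n%:R / 4 by move: Tc; rewrite -mulrAC ler_pdivrMr//; lra.
  move: cT le_S; rewrite -!(ler_nat R) !natrD; lra.
by move=> /filter_ex[].
Unshelve. all: end_near.
Qed.
End sieve.

Lemma irrational_combination (R : realType) (alpha : R) (a r : int) :
  irrational alpha -> r != 0 -> a%:~R - r%:~R * alpha != 0.
Proof.
move=> irr r0; apply/negP => /eqP E; apply: irr.
exists (a%:~R / r%:~R) => //.
rewrite fmorph_div !rmorph_int; apply: (mulfI (_ : r%:~R != 0)).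
  by rewrite intr_eq0.
by rewrite mulrCA divff ?intr_eq0// mulr1; lra.
Qed.

(* One step of Euclid's algorithm on the pair (1, theta): replace theta by the
   smaller of the remainder of 1 modulo theta and its complement. *)
Lemma irrational_combination_halve (R : realType) (alpha theta : R) (a r : int) :
  irrational alpha -> r != 0 -> theta = a%:~R - r%:~R * alpha ->
  0 < theta <= 1 ->
  exists a' r' : int, r' != 0 /\ 0 < a'%:~R - r'%:~R * alpha <= theta / 2.
Proof.
move=> irr r0 thetaE /andP[t0 t1].
set j := Num.trunc theta^-1.
have /andP[j1 j2] : j%:R <= theta^-1 < j.+1%:R by apply: truncn_itv; rewrite invr_ge0 ltW.
have j0 : (0 < j)%N by rewrite truncn_gt0 invf_ge1.
have jt1 : j%:R * theta <= 1 by move: j1; rewrite -[theta^-1]mul1r ler_pdivlMr.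
have jt2 : 1 < j%:R * theta + theta.
  by move: j2; rewrite -[theta^-1]mul1r ltr_pdivrMr// -natr1 mulrDl mul1r.
have rhoE : 1 - j%:R * theta = (1 - j%:Z * a)%:~R - (- (j%:Z * r))%:~R * alpha.
  by rewrite thetaE !(rmorphB, rmorphN, rmorphM)/= -!pmulrn; ring.
have rho0 : 1 - j%:R * theta != 0.
  by rewrite rhoE irrational_combination// oppr_eq0 mulf_neq0//; lia.
have {}rho0 : 0 < 1 - j%:R * theta by rewrite lt_def rho0 subr_ge0.
have [le|gt] := leP (1 - j%:R * theta) (theta / 2).
  exists (1 - j%:Z * a), (- (j%:Z * r)); rewrite -rhoE rho0 le; split => //.
  by rewrite oppr_eq0 mulf_neq0//; lia.
have E : j%:R * theta + theta - 1 =
    ((j%:Z + 1) * a - 1)%:~R - ((j%:Z + 1) * r)%:~R * alpha.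
  by rewrite thetaE !(rmorphB, rmorphD, rmorphM)/= -!pmulrn; ring.
exists ((j%:Z + 1) * a - 1), ((j%:Z + 1) * r); rewrite -E; split; last by lra.
by rewrite mulf_neq0//; lia.
Qed.

Lemma irrational_combination_small (R : realType) (alpha : R) (n : nat) :
  irrational alpha ->
  exists a r : int, r != 0 /\ 0 < a%:~R - r%:~R * alpha <= 2^-1 ^+ n.
Proof.
move=> irr; elim: n => [|n [a [r [r0 /andP[h0 h1]]]]].
  exists (Num.floor alpha + 1), 1; split => //.
  have /andP[f1 f2] := floor_itv alpha.
  have := @irrational_combination R alpha (Num.floor alpha + 1) 1 irr isT.
  move: f2; rewrite rmorphD/= mul1r expr0 => f2 h.
  by apply/andP; split; lra.
have h1' : a%:~R - r%:~R * alpha <= 1.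
  by rewrite (le_trans h1)// exprn_ile1// ?invr_ge0// invf_le1// ler1n.
have [a' [r' [r'0 /andP[h0' hle]]]] :=
  irrational_combination_halve _ _ _ a r irr r0 erefl (introT andP (conj h0 h1')).
exists a', r'; split => //; rewrite h0' (le_trans hle)//.
by rewrite exprS mulrC ler_wpM2l// invr_ge0.
Qed.

Lemma irrational_approx (R : realType) (alpha delta : R) :
  0 < alpha -> irrational alpha -> 0 < delta ->
  exists a r : nat, 0 < a%:R - r%:R * alpha < delta.
Proof.
move=> alpha0 irr delta0.
have min0 : 0 < Num.min delta 1 by rewrite lt_min delta0/=.
have [n] := filter_ex (near_infty_natSinv_expn_lt (PosNum min0)).
rewrite mul1r -exprVn /= => hn.
have [a [r [r0 /andP[h0 h1]]]] := @irrational_combination_small R alpha n irr.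
set theta := a%:~R - r%:~R * alpha in h0 h1.
have : theta < Num.min delta 1 by exact: le_lt_trans hn.
rewrite lt_min => /andP[td t1].
have nat_combination (a' r' : int) :
  0 < r' -> 0 < a'%:~R - r'%:~R * alpha < delta ->
  exists a r : nat, 0 < a%:R - r%:R * alpha < delta.
  case: r' => // r' r'0 /andP[h1' h2'].
  have r'a0 : (0 : R) <= r'%:~R * alpha by apply: mulr_ge0; [exact: ler0n|exact: ltW].
  have : (0 : R) < a'%:~R by lra.
  rewrite ltr0z; case: a' h1' h2' => // a' h1' h2' _.
  by exists a', r'; apply/andP.
have [rpos|rneg] := ltP 0 r; first by apply: (nat_combination a r rpos); apply/andP.
set j := Num.trunc theta^-1.
have /andP[j1 j2] : j%:R <= theta^-1 < j.+1%:R by apply: truncn_itv; rewrite invr_ge0 ltW.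
have j0 : (0 < j)%N by rewrite truncn_gt0 invf_ge1// ltW.
have jt1 : j%:R * theta <= 1 by move: j1; rewrite -[theta^-1]mul1r ler_pdivlMr.
have jt2 : 1 < j%:R * theta + theta.
  by move: j2; rewrite -[theta^-1]mul1r ltr_pdivrMr// -natr1 mulrDl mul1r.
have rhoE : 1 - j%:R * theta = (1 - j%:Z * a)%:~R - (- (j%:Z * r))%:~R * alpha.
  by rewrite /theta !(rmorphB, rmorphN, rmorphM)/= -!pmulrn; ring.
have r_lt0 : r < 0 by rewrite lt_neqAle r0.
apply: (nat_combination (1 - j%:Z * a) (- (j%:Z * r))).
  by rewrite oppr_gt0 pmulr_rlt0// ltz_nat.
rewrite -rhoE; apply/andP; split; last by lra.
rewrite lt_def subr_ge0 jt1 andbT rhoE irrational_combination// oppr_eq0 mulf_neq0//.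
by rewrite gt_eqF// ltz_nat.
Qed.

Lemma irrational_approx_itv (R : realType) (alpha eta : R) (q : nat) :
  0 < alpha -> irrational alpha -> 0 < eta -> (0 < q)%N ->
  exists a r : nat, [/\ (q %| a)%N, (q %| r)%N &
    eta <= a%:R - r%:R * alpha < 2 * eta].
Proof.
move=> alpha0 irr eta0 q0.
have [a [r /andP[h0 h1]]] : exists a r : nat, 0 < a%:R - r%:R * alpha < eta / q%:R.
  by apply: irrational_approx => //; rewrite divr_gt0// ltr0n.
set theta := (a%:R - r%:R * alpha) * q%:R.
have t0 : 0 < theta by rewrite mulr_gt0// ltr0n.
have t1 : theta < eta by move: h1; rewrite ltr_pdivlMr// ltr0n.
set j := Num.trunc (eta / theta).
have /andP[] : j%:R <= eta / theta < j.+1%:R.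
  by apply: truncn_itv; rewrite divr_ge0// ltW.
rewrite ler_pdivlMr// ltr_pdivrMr// => j1 j2.
exists (j.+1 * q * a)%N, (j.+1 * q * r)%N.
rewrite -!mulnA !(mulnCA _ q) !dvdn_mulr//; split => //.
have -> : (q * (j.+1 * a))%:R - (q * (j.+1 * r))%:R * alpha = j.+1%:R * theta.
  by rewrite !natrM /theta; ring.
apply/andP; split; first exact: ltW.
by rewrite -natr1 mulrDl mul1r; lra.
Qed.

Lemma eqn_mod_arith (q c D u u' : nat) : coprime q D ->
  (q %| c + D * u)%N -> (q %| c + D * u')%N -> u = u' %[mod q].
Proof.
wlog uu' : u u' / (u <= u')%N => [hw co qu qu'|co qu qu'].
  have [le|lt] := leqP u u'; first exact: hw.
  by symmetry; apply: hw => //; exact: ltnW.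
apply/esym/eqP; rewrite eqn_mod_dvd// -(Gauss_dvdr _ co) mulnBr.
by rewrite -(subnDl c) dvdn_sub.
Qed.

Lemma int_mul_lt1 (R : realType) (alpha : R) (k : int) :
  1 <= alpha -> -1 < alpha * k%:~R < 1 -> k = 0.
Proof.
move=> alpha1 /andP[]; have [k0|k0|->//] := ltgtP k 0.
  have : k%:~R <= -1 :> R by rewrite -[1]/(1%:~R) -rmorphN/= ler_int; lia.
  by move: (k%:~R : R) => x *; exfalso; nra.
have : 1 <= k%:~R :> R by rewrite -[1]/(1%:~R) ler_int; lia.
by move: (k%:~R : R) => x *; exfalso; nra.
Qed.

Section strip.
Variables (R : realType) (alpha beta eta : R).

Definition strip_snd (u : nat) : nat := Num.trunc (alpha * u%:R + beta).
Definition strip (u : nat) : bool := alpha * u%:R + beta - (strip_snd u)%:R < eta.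

Lemma strip_snd_itv u : 0 <= alpha -> 0 <= beta ->
  (strip_snd u)%:R <= alpha * u%:R + beta < (strip_snd u)%:R + 1.
Proof.
move=> alpha0 beta0; rewrite natr1; apply: truncn_itv.
by rewrite addr_ge0// mulr_ge0.
Qed.

Lemma strip_snd_inj u u' : 1 < alpha -> 0 <= beta ->
  strip_snd u = strip_snd u' -> u = u'.
Proof.
move=> alpha1 beta0 E; have alpha0 : 0 <= alpha by lra.
have := strip_snd_itv u alpha0 beta0; have := strip_snd_itv u' alpha0 beta0; rewrite E.
move=> /andP[h1 h2] /andP[h3 h4].
have k1 : - 1 < alpha * (u%:Z - u'%:Z)%:~R < 1.
  by rewrite rmorphB/= -!pmulrn; apply/andP; split; lra.
suff: u%:Z - u'%:Z = 0 by lia.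
exact: int_mul_lt1 (ltW alpha1) k1.
Qed.

Lemma strip_dense : 1 < alpha -> irrational alpha -> 0 <= beta ->
  0 < eta -> eta <= 6^-1 -> \forall n \near \oo, eta / 6 * n%:R <= (cnt strip n)%:R.
Proof.
move=> alpha1 irr beta0 eta0 eta6; have alpha0 : 0 < alpha by lra.
have eta20 : 0 < eta / 2 by rewrite divr_gt0.
have [a [r [_ _]]] := @irrational_approx_itv R alpha (eta / 2) 1 alpha0 irr eta20 isT.
set theta := a%:R - r%:R * alpha; rewrite mulrCA divff ?mulr1 // => /andP[t1 t2].
have t0 : 0 < theta by lra.
set L := (Num.trunc (2 / eta)).+1.
have L1 : L%:R <= 3 / eta.
  have /andP[h _] := truncn_itv (divr_ge0 (ler0n R 2) (ltW eta0)).
  rewrite /L -natr1; have : 1 <= eta^-1 by rewrite invf_ge1//; lra.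
  lra.
have cov u : exists2 j, (j < L)%N & strip (u + j * r)%N.
  have /andP[v1 v2] := strip_snd_itv u (ltW alpha0) beta0.
  set phi := alpha * u%:R + beta - (strip_snd u)%:R.
  have phi0 : 0 <= phi by rewrite /phi; lra.
  have phi1 : phi < 1 by rewrite /phi; lra.
  have /andP[] := truncn_itv (divr_ge0 phi0 (ltW t0)).
  set j := Num.trunc (phi / theta).
  rewrite -natr1 ler_pdivlMr// ltr_pdivrMr// mulrDl mul1r => j1 j2.
  exists j.
    rewrite ltnS truncn_ge_nat; last by rewrite divr_ge0// ltW.
    by rewrite ler_pdivlMr//; nra.
  have E : alpha * (u + j * r)%:R + beta = (strip_snd u + j * a)%:R + (phi - j%:R * theta).
    by rewrite !natrD !natrM /phi /theta; ring.
  rewrite /strip (_ : strip_snd _ = strip_snd u + j * a)%N; first by rewrite E; lra.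
  by apply: truncn_def; rewrite -natr1 E; apply/andP; split; lra.
near=> n.
have nL : (2 * (L * r) <= n)%N by near: n; exact: nbhs_infty_ge.
have := @cnt_covering strip (n - L * r) L r cov; rewrite subnK; last by lia.
move=> h; have : (n <= 2 * (L * cnt strip n))%N by lia.
rewrite -(ler_nat R) !natrM => {}h.
have : (cnt strip n)%:R * L%:R <= (cnt strip n)%:R * (3 / eta) by rewrite ler_wpM2l.
rewrite mulrA ler_pdivlMr// => h'.
have : n%:R * eta <= 2 * (L%:R * (cnt strip n)%:R) * eta by rewrite ler_wpM2r// ltW.
lra.
Unshelve. all: end_near.
Qed.

Definition strip_period : nat := Num.trunc ((1 - eta) / (2 * eta)).

Lemma strip_period_bounds : 0 < eta -> eta <= 6^-1 ->
  strip_period%:R * (2 * eta) <= 1 - eta /\ 1 <= strip_period%:R * (4 * eta).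
Proof.
move=> eta0 eta6.
have /andP[] : strip_period%:R <= (1 - eta) / (2 * eta) < strip_period.+1%:R.
  by apply: truncn_itv; rewrite divr_ge0//; lra.
rewrite -natr1 ler_pdivlMr ?mulr_gt0// ltr_pdivrMr ?mulr_gt0//; lra.
Qed.

(* The shift by (r, a) moves a point of the strip across it by an amount between
   eta, the width, and 2 eta, so strip_period successive shifts of a point meet
   the strip at most once. *)
Lemma strip_shift a r u u' d : 1 < alpha -> 0 <= beta -> 0 < eta -> eta <= 6^-1 ->
  eta <= a%:R - r%:R * alpha -> a%:R - r%:R * alpha < 2 * eta ->
  strip u -> strip u' -> (d < strip_period)%N ->
  u = (u' + d * r)%N \/ strip_snd u = (strip_snd u' + d * a)%N -> d = 0%N.
Proof.
move=> alpha1 beta0 eta0 eta6; have alpha0 : 0 <= alpha by lra.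
have [K_le _] := strip_period_bounds eta0 eta6.
set theta := a%:R - r%:R * alpha => theta1 theta2.
rewrite /strip => Su Su' dK uv.
have /andP[h1 _] := strip_snd_itv u alpha0 beta0.
have /andP[h1' _] := strip_snd_itv u' alpha0 beta0.
set e := (alpha * u%:R + beta - (strip_snd u)%:R)
  - (alpha * u'%:R + beta - (strip_snd u')%:R) + d%:R * theta.
have dt1 : d%:R * eta <= d%:R * theta by rewrite ler_wpM2l.
have dt2 : d%:R * theta <= strip_period%:R * (2 * eta).
  by apply: ler_pM => //; rewrite ?ler_nat; [lra|exact: ltnW|lra].
have d0 : (0 : R) <= d%:R by exact: ler0n.
have d_eta0 : 0 <= d%:R * eta by rewrite mulr_ge0// ltW.
have e1 : - eta < e by rewrite /e; lra.
have e2 : e < 1 by rewrite /e; lra.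
have E : e = alpha * (u%:Z - u'%:Z - (d * r)%N%:Z)%:~R
    - ((strip_snd u)%:Z - (strip_snd u')%:Z - (d * a)%N%:Z)%:~R.
  by rewrite !rmorphB/= -!pmulrn !natrM /e /theta; ring.
suff e0 : e = 0.
  case: d uv dK d0 d_eta0 dt1 dt2 @e e1 e2 E e0 => // d _ _ _ _ dt1 _ e _ _ _.
  rewrite /e => e0.
  have : eta <= d.+1%:R * eta by rewrite ler_peMl ?ler1n// ltW.
  by move=> ?; exfalso; lra.
case: uv => [uE|vE].
  have u0 : u%:Z - u'%:Z - (d * r)%N%:Z = 0.
    by rewrite uE PoszD (addrAC u'%:Z) subrr add0r subrr.
  move: E; rewrite u0 mulr0 sub0r; set k := _ - _ - _; move=> E.
  by rewrite E (@int_mul_lt1 R 1 k) ?oppr0// mul1r; apply/andP; split; lra.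
have v0 : (strip_snd u)%:Z - (strip_snd u')%:Z - (d * a)%N%:Z = 0.
  by rewrite vE PoszD (addrAC (strip_snd u')%:Z) subrr add0r subrr.
move: E; rewrite v0 subr0; set k := _ - _ - _; move=> E.
by rewrite E (@int_mul_lt1 R alpha k) ?mulr0//; [exact: ltW|apply/andP; split; lra].
Qed.

End strip.

Arguments strip_snd {R} alpha beta u.
Arguments strip {R} alpha beta eta u.
Arguments strip_period {R} eta.

Lemma cnt_packing_shift (E : pred nat) (v : nat -> nat) (q s K n N : nat) :
  (q %| s)%N ->
  (forall t t', E t -> E t' -> v t = v t' %[mod q]) ->
  (forall t t' d, E t -> E t' -> (d < K)%N -> v t = (v t' + d * s)%N -> d = 0%N) ->
  (forall t t', v t = v t' -> t = t') ->
  (forall t, (t < n)%N -> E t -> (v t + q + K * s <= N)%N) ->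
  (cnt E n * (q * K) <= N)%N.
Proof.
move=> qs vq vshift vinj vN; apply: cnt_packing vN _.
move=> t t' i i' j j' _ _ Et Et' iq iq' jK jK' ijE.
have ii' : i = i'.
  apply: (@eqn_mod_rem q (v t + j * s) (v t' + j' * s)) => //; last by lia.
  rewrite -modnDmr -[in RHS]modnDmr.
  by rewrite !(eqP (dvdn_mull _ qs)) !addn0; exact: vq.
subst i'.
suff jj' : j = j' by split => //; apply: vinj; move: ijE; rewrite jj'; lia.
have [le|/ltnW le] := leqP j j'.
  have : (j' - j)%N = 0%N.
    apply: (vshift t t') => //; first by lia.
    by rewrite mulnBl; have := leq_mul2r s j j'; rewrite le orbT; lia.
  by lia.
have : (j - j')%N = 0%N.
  apply: (vshift t' t) => //; first by lia.
  by rewrite mulnBl; have := leq_mul2r s j' j; rewrite le orbT; lia.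
by lia.
Qed.

Lemma strip_cnt_class (R : realType) (alpha beta eta : R) (E : pred nat)
    (v : nat -> nat) (q s : nat) :
  1 < alpha -> 0 <= beta -> 0 < eta -> eta <= 6^-1 ->
  (0 < q)%N -> (q %| s)%N ->
  (forall t t', E t -> E t' -> v t = v t' %[mod q]) ->
  (forall t t' d, E t -> E t' -> (d < strip_period eta)%N ->
    v t = (v t' + d * s)%N -> d = 0%N) ->
  (forall t t', v t = v t' -> t = t') ->
  (forall t, (v t)%:R <= alpha * t%:R + beta) ->
  \forall n \near \oo, (cnt E n)%:R <= 48 * alpha * (eta / 6) / q%:R * n%:R.
Proof.
move=> alpha1 beta0 eta0 eta6 q0 qs vq vshift vinj vle.
have [_ K1] := strip_period_bounds _ _ eta0 eta6.
set K := strip_period eta in vshift K1 *.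
near=> n.
have nbig : beta + q%:R + (K * s)%:R <= n%:R by near: n; exact: nbhs_infty_ger.
have an0 : 0 <= alpha * n%:R + beta by rewrite addr_ge0// mulr_ge0//; lra.
have /andP[Nle _] := truncn_itv an0.
have : (cnt E n * (q * K) <= Num.trunc (alpha * n%:R + beta) + q + K * s)%N.
  apply: cnt_packing_shift vq vshift vinj _ => // t tn _.
  rewrite !leq_add2r truncn_ge_nat// (le_trans (vle t))//.
  by rewrite lerD2r ler_wpM2l ?ler_nat ?(ltnW tn)//; lra.
rewrite -(ler_nat R) !natrD !natrM.
set c := (cnt E n)%:R => h.
have {}h : c * (q%:R * K%:R) <= 2 * (alpha * n%:R).
  have : n%:R <= alpha * n%:R by rewrite ler_peMl//; lra.
  by rewrite natrM in nbig; lra.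
have cq : 0 <= c * q%:R by rewrite mulr_ge0// ler0n.
have : c * q%:R <= 8 * alpha * eta * n%:R.
  have : c * q%:R * 1 <= c * q%:R * (K%:R * (4 * eta)) by rewrite ler_wpM2l.
  have : c * (q%:R * K%:R) * (4 * eta) <= 2 * (alpha * n%:R) * (4 * eta).
    by rewrite ler_wpM2r//; lra.
  lra.
rewrite -ler_pdivlMr ?ltr0n// => /le_trans; apply.
by rewrite le_eqVlt; apply/orP; left; apply/eqP; field; rewrite pnatr_eq0 -lt0n.
Unshelve. all: end_near.
Qed.

Lemma coprime_fact (p n : nat) : prime p -> (n < p)%N -> coprime p n`!.
Proof.
move=> pp; elim: n => [|n IH] np; first by rewrite coprimen1.
by rewrite factS coprimeMr IH ?(ltnW np)// andbT prime_coprime// gtnNdvd.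
Qed.

Lemma prime_ndvd_arith (q z u : nat) : prime q -> (q < z.+1)%N ->
  ~~ (q %| 1 + z`! * u)%N.
Proof.
move=> pq qz; rewrite dvdn_addl ?dvdn_mulr//.
  by rewrite dvdn1 neq_ltn prime_gt1 ?orbT.
by rewrite dvdn_fact// prime_gt0.
Qed.

Section pairs.
Variables (R : realType) (Q : pred nat).
Hypothesis Q_prime : forall q, Q q -> prime q.
Hypothesis tailQ : forall d : R, 0 < d ->
  \forall Z \near \oo, forall Y, \sum_(Z <= q < Y | Q q) q%:R^-1 <= d.

Lemma sieve_level (C : R) (B : nat) : 0 < C -> exists2 z, (B <= z)%N &
  forall Y, C * \sum_(z.+1 <= q < Y | Q q) q%:R^-1 <= 8^-1.
Proof.
move=> C0; have d0 : 0 < (8 * C)^-1 by rewrite invr_gt0 mulr_gt0.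
near \oo => z.
exists z => [|Y]; first by near: z; exact: nbhs_infty_ge.
have tz : forall Y, \sum_(z.+1 <= q < Y | Q q) q%:R^-1 <= (8 * C)^-1.
  near: z; case: (tailQ _ d0) => N _ hN; exists N => // m /= Nm.
  by apply: hN => /=; rewrite (leq_trans Nm).
apply: le_trans (ler_wpM2l (ltW C0) (tz Y)) _.
by rewrite invfM mulrCA divff ?mulr1// gt_eqF.
Unshelve. all: end_near.
Qed.

Lemma irrational_pairs (alpha eps : R) (T : nat) :
  1 < alpha -> irrational alpha -> 0 < eps ->
  exists x y, [/\ (T < x)%N, (0 < y)%N, ~~ has Q (divisors x), ~~ has Q (divisors y)
                & `|x%:R - alpha * y%:R| < eps].
Proof.
move=> alpha1 irr eps0.
have C0 : 0 < 48 * alpha by lra.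
have [z _ hz] := sieve_level _ 0 C0.
set D := z`!; have D0 : 0 < D%:R :> R by rewrite ltr0n fact_gt0.
set eta := Num.min (eps / D%:R) 6^-1.
have eta0 : 0 < eta by rewrite lt_min divr_gt0//= invr_gt0.
have eta6 : eta <= 6^-1 by rewrite ge_min lexx orbT.
have etaD : D%:R * eta <= eps by rewrite mulrC -ler_pdivlMr// ge_min lexx.
set beta := (alpha - 1) / D%:R.
have beta0 : 0 <= beta by rewrite divr_ge0 ?ler0n//; lra.
have alpha0 : 0 <= alpha by lra.
set S := strip alpha beta eta; set v := strip_snd alpha beta.
have betaD : D%:R * beta = alpha - 1 by rewrite mulrC divfK// gt_eqF.
have vE u : (1 + D * v u)%:R = alpha * (1 + D * u)%:R
    - D%:R * (alpha * u%:R + beta - (v u)%:R).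
  by rewrite !natrD !natrM !mulrDr betaD; ring.
set A := ((Num.trunc alpha).+1 * D.+1)%N.
have arith_le t : (1 + D * t <= D.+1 * t.+1)%N by rewrite mulSn mulnS; lia.
have sx : sievable R Q S (fun u => 1 + D * u)%N z.+1 A (eta / 6) (48 * alpha).
  split.
  - move=> t t' _ _ /eqP; rewrite eqn_add2l eqn_pmul2l ?fact_gt0//.
    by move/eqP.
  - move=> t _; rewrite add1n ltnS leq0n/= -add1n.
    by rewrite (leq_trans (arith_le t))// -mulnA leq_pmull.
  - by move=> t q _ Qq qz; apply: prime_ndvd_arith => //; exact: Q_prime.
  - move=> q Qq zq; have pq := Q_prime _ Qq.
    have [a [r [qa qr /andP[t1 t2]]]] := irrational_approx_itv _ _ _ _
      (lt_trans ltr01 alpha1) irr eta0 (prime_gt0 pq).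
    apply: (@strip_cnt_class _ _ beta _ _ id q r) => //; first exact: prime_gt0.
    + move=> t t' /andP[_ qt] /andP[_ qt'].
      exact: eqn_mod_arith (coprime_fact _ _ pq zq) qt qt'.
    + move=> t t' d /andP[St _] /andP[St' _] dK E.
      by apply: (@strip_shift R alpha beta eta a r t t' d) => //; left.
    + move=> t /=; have : t%:R <= alpha * t%:R by rewrite ler_peMl//; lra.
      by lra.
have sy : sievable R Q S (fun u => 1 + D * v u)%N z.+1 A (eta / 6) (48 * alpha).
  split.
  - move=> t t' _ _ /eqP; rewrite eqn_add2l eqn_pmul2l ?fact_gt0// => /eqP.
    exact: strip_snd_inj.
  - move=> t _; rewrite add1n ltnS leq0n/= -add1n -(ler_nat R) vE.
    have /andP[h _] := strip_snd_itv _ alpha beta t alpha0 beta0.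
    have h2 : 0 <= D%:R * (alpha * t%:R + beta - (v t)%:R).
      by rewrite mulr_ge0 ?subr_ge0// ler0n.
    apply: (@le_trans _ _ ((Num.trunc alpha).+1%:R * (1 + D * t)%:R)).
      rewrite lerBlDr -[leLHS]addr0 lerD// ler_wpM2r//.
      by apply: ltW; exact: truncnS_gt.
    by rewrite -natrM ler_nat /A -mulnA leq_mul2l arith_le orbT.
  - by move=> t q _ Qq qz; apply: prime_ndvd_arith => //; exact: Q_prime.
  - move=> q Qq zq; have pq := Q_prime _ Qq.
    have [a [r [qa qr /andP[t1 t2]]]] := irrational_approx_itv _ _ _ _
      (lt_trans ltr01 alpha1) irr eta0 (prime_gt0 pq).
    apply: (@strip_cnt_class _ _ beta _ _ v q a) => //; first exact: prime_gt0.
    + move=> t t' /andP[_ qt] /andP[_ qt'].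
      exact: eqn_mod_arith (coprime_fact _ _ pq zq) qt qt'.
    + move=> t t' d /andP[St _] /andP[St' _] dK E.
      by apply: (@strip_shift R alpha beta eta a r t t' d) => //; right.
    + by move=> t t'; exact: strip_snd_inj.
    + by move=> t; have /andP[] := strip_snd_itv _ alpha beta t alpha0 beta0.
have dense := strip_dense _ _ _ _ alpha1 irr beta0 eta0 eta6.
have c0 : 0 < eta / 6 by rewrite divr_gt0.
have [t [Tt St xt yt]] := sieve_pair R Q S (fun q h => prime_gt0 (Q_prime q h)) tailQ
  z.+1 A _ _ c0 hz dense _ _ T.+1 sy sx.
exists (1 + D * v t)%N, (1 + D * t)%N; split => //.
  have tv : (t <= v t)%N.
    rewrite /v/strip_snd truncn_ge_nat; last by rewrite addr_ge0// mulr_ge0.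
    have : t%:R <= alpha * t%:R by rewrite ler_peMl//; lra.
    by lra.
  rewrite add1n ltnS (leq_trans (ltnW Tt))// (leq_trans tv)// leq_pmull//.
  exact: fact_gt0.
have /andP[h _] := strip_snd_itv _ alpha beta t alpha0 beta0.
rewrite vE addrAC subrr add0r normrN ger0_norm; last by rewrite mulr_ge0 ?subr_ge0// ler0n.
by rewrite (lt_le_trans _ etaD)// ltr_pM2l.
Qed.

End pairs.

Lemma rational_gt1 (R : realType) (alpha : R) :
  rational alpha -> alpha \isn't a Num.int -> 1 < alpha ->
  exists a b : nat, [/\ coprime a b, (1 < b)%N, (b < a)%N & alpha = a%:R / b%:R].
Proof.
move=> [q _ <-] qZ q1; have q0 : 0 < q by rewrite -(ltr0q R) (lt_trans _ q1).
exists `|numq q|%N, `|denq q|%N.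
have qE : ratr q = `|numq q|%N%:R / `|denq q|%N%:R :> R.
  by rewrite /ratr !pmulrn !gez0_abs// ltW// numq_gt0.
have d0 : (0 < `|denq q|)%N by rewrite absz_gt0 denq_neq0.
split => //; first exact: coprime_num_den.
  rewrite ltn_neqAle d0 andbT; apply/negP => /eqP d1.
  by move: qZ; rewrite qE -d1 divr1 natr_int.
by move: q1; rewrite qE ltr_pdivlMr ?ltr0n// mul1r ltr_nat.
Qed.

Section rational_pairs.
Variables (R : realType) (Q : pred nat).
Hypothesis Q_prime : forall q, Q q -> prime q.
Hypothesis tailQ : forall d : R, 0 < d ->
  \forall Z \near \oo, forall Y, \sum_(Z <= q < Y | Q q) q%:R^-1 <= d.

Lemma sievable_arith (z u B A : nat) : (0 < B)%N -> (z`! * (u + B) < A)%N ->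
  (forall q, Q q -> (z < q)%N -> coprime q B) ->
  sievable R Q xpredT (fun t => 1 + z`! * (u + B * t))%N z.+1 A 1 2.
Proof.
move=> B0 BA coB; have D0 := fact_gt0 z; split.
- move=> t t' _ _ /eqP; rewrite eqn_add2l eqn_pmul2l// eqn_add2l eqn_pmul2l//.
  by move/eqP.
- move=> t _; apply/andP; split => //.
  apply: leq_trans (leq_mul BA (leqnn t.+1)); rewrite mulSn leq_add// -mulnA.
  rewrite leq_mul2l mulnDl leq_add ?orbT// ?leq_pmulr// leq_mul2l.
  by rewrite leqnSn !orbT.
- by move=> t q _ Qq qz; apply: prime_ndvd_arith => //; exact: Q_prime.
move=> q Qq zq; have pq := Q_prime _ Qq.
near=> n.
have qn : (q <= n)%N by near: n; exact: nbhs_infty_ge.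
rewrite mulr1 mulrAC ler_pdivlMr ?ltr0n ?prime_gt0// -!natrM ler_nat.
have := @cnt_packing (fun t => xpredT t && (q %| 1 + z`! * (u + B * t))%N) n q 1 0
  (n + q) id.
rewrite muln1 => h; apply: (leq_trans (h _ _)); last by lia.
  by move=> t tn _; lia.
move=> t t' i i' j j' _ _ qt qt' iq iq'; rewrite !ltnS !leqn0 => /eqP-> /eqP->.
rewrite !addn0 => E.
have ii' : i = i'.
  apply: eqn_mod_rem iq iq' E.
  apply: (@eqn_mod_arith q (1 + z`! * u) (z`! * B)).
  - by rewrite coprimeMr coprime_fact// coB.
  - by move: qt; rewrite /= mulnDr mulnA addnA.
  - by move: qt'; rewrite /= mulnDr mulnA addnA.
by split => //; lia.
Unshelve. all: end_near.
Qed.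

Lemma rational_pairs (alpha eps : R) (T : nat) :
  1 < alpha -> rational alpha -> alpha \isn't a Num.int -> 0 < eps ->
  exists x y k, [/\ (T < x)%N, (0 < y)%N, ~~ has Q (divisors x), ~~ has Q (divisors y)
                & `|x%:R - alpha ^+ k.+1 * y%:R| < eps].
Proof.
move=> alpha1 rat alphaZ eps0.
have [a [b [ab b1 ba alphaE]]] := rational_gt1 _ _ rat alphaZ alpha1.
have [z az hz] := @sieve_level R Q tailQ 2 a ltac:(by []).
set D := z`!; have D0 : (0 < D)%N by exact: fact_gt0.
have [k hk] : exists k, D%:R / (b ^ k.+1)%:R < eps.
  have e0 : 0 < eps / D%:R by rewrite divr_gt0// ltr0n.
  have [k] := filter_ex (near_infty_natSinv_expn_lt (PosNum e0)).
  rewrite /= mul1r => hk; exists k.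
  move: hk; rewrite ltr_pdivlMr ?ltr0n// mulrC; apply: le_lt_trans.
  have b0 : (0 < b ^ k.+1)%N by rewrite expn_gt0 (ltnW b1).
  rewrite ler_wpM2l// lef_pV2 ?posrE ?exprn_gt0 ?ltr0n// -natrX ler_nat.
  by apply: (@leq_trans (2 ^ k.+1)); rewrite ?leq_exp2r// leq_exp2l.
set A := (a ^ k.+1)%N; set B := (b ^ k.+1)%N in hk.
have B0 : (0 < B)%N by rewrite expn_gt0 (ltnW b1).
have A0 : (0 < A)%N by rewrite expn_gt0 (ltn_trans _ ba)// ltnW.
have BA : (B <= A)%N by rewrite leq_exp2r// ltnW.
have coAB : coprime A B by rewrite coprimeXl// coprimeXr.
set h := ((A - B) %% D)%N; set w := ((A - B) %/ D)%N.
have [u [v uvE]] : exists u v, (B * v = A * u + w)%N.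
  pose X := chinese A B 0 (B.-1 * w).
  have AX : (A %| X)%N by rewrite /dvdn chinese_modl// mod0n.
  exists (X %/ A)%N, ((X + w) %/ B)%N.
  rewrite mulnC divnK; first by rewrite mulnC divnK.
  rewrite /dvdn -modnDml chinese_modr// modnDml -[X in (_ + X)%N]mul1n -mulnDl.
  by rewrite addn1 prednK// modnMr.
have hD : (h < D)%N by rewrite ltn_mod.
have ABE : (A = B + D * w + h)%N.
  by have := divn_eq (A - B) D; rewrite -/w -/h mulnC; lia.
have co c q : (0 < c)%N -> (c <= a)%N -> Q q -> (z < q)%N -> coprime q (c ^ k.+1).
  move=> c0 ca Qq zq; rewrite coprimeXr// prime_coprime ?Q_prime//.
  by rewrite gtnNdvd// (leq_ltn_trans _ zq)// (leq_trans ca).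
have a0 : (0 < a)%N by rewrite (ltn_trans _ ba)// ltnW.
set M := (D * (v + A) + D * (u + B)).+1.
have sx := sievable_arith z v A M A0 (leq_addr _ _) (fun q => co a q a0 (leqnn a)).
have sy := sievable_arith z u B M B0 (leq_addl _ _) (fun q => co b q (ltnW b1) (ltnW ba)).
have dense : \forall n \near \oo, 1 * n%:R <= (cnt xpredT n)%:R :> R.
  by apply: nearW => n; rewrite mul1r /cnt sum1_card card_ord.
have [t [Tt _ xt yt]] := sieve_pair R Q xpredT (fun q h => prime_gt0 (Q_prime q h)) tailQ
  z.+1 M 1 2 ltr01 hz dense _ _ T.+1 sx sy.
exists (1 + D * (v + A * t))%N, (1 + D * (u + B * t))%N, k; split => //.
  rewrite add1n ltnS (leq_trans (ltnW Tt))// (leq_trans _ (leq_pmull _ D0))//.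
  by rewrite (leq_trans (leq_pmull t A0))// leq_addl.
have E : (A * (1 + D * (u + B * t)) = B * (1 + D * (v + A * t)) + h)%N.
  have -> : (B * (1 + D * (v + A * t)) = B + D * (B * v) + D * A * B * t)%N by ring.
  by rewrite uvE {1}mulnDr muln1 {1}ABE; ring.
have BR0 : (0 : R) < B%:R by rewrite ltr0n.
move: E; set x := (1 + D * (v + A * t))%N; set y := (1 + D * (u + B * t))%N => E.
rewrite alphaE expr_div_n -!natrX -/A -/B mulrAC -natrM E natrD natrM mulrDl.
rewrite (mulrAC B%:R) divff ?gt_eqF// mul1r opprD addrA subrr add0r normrN ger0_norm.
  by rewrite (le_lt_trans _ hk)// ler_wpM2r ?invr_ge0// ler_nat ltnW.
by rewrite divr_ge0.
Qed.
End rational_pairs.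

Lemma esum_inv_tail (R : realType) (Q : pred nat) (d : R) :
  (\esum_(p in [set p | Q p]) (p%:R^-1 : R)%:E < +oo)%E -> 0 < d ->
  \forall Z \near \oo, forall Y, \sum_(Z <= q < Y | Q q) q%:R^-1 <= d.
Proof.
move=> fin d0.
have inv0 q : (0 : R) <= q%:R^-1 by rewrite invr_ge0 ler0n.
pose s n : R := \sum_(0 <= q < n | Q q) q%:R^-1.
have s_split m n : (m <= n)%N -> s n = s m + \sum_(m <= q < n | Q q) q%:R^-1.
  by move=> mn; rewrite /s (@big_cat_nat _ _ _ m 0 n).
have s_mono : {homo s : m n / (m <= n)%N >-> m <= n}.
  by move=> m n mn; rewrite (s_split m n mn) lerDl sumr_ge0.
have s_ub : has_ubound (range s).
  exists (fine (\esum_(p in [set p | Q p]) (p%:R^-1 : R)%:E)%E) => _ [n _ <-].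
  rewrite -lee_fin fineK; last by rewrite ge0_fin_numE// esum_ge0// => *; rewrite lee_fin.
  rewrite -nneseries_esum; last by move=> *; rewrite lee_fin.
  rewrite /s -sumEFin; apply: nneseries_lim_ge => *; by rewrite lee_fin.
have s_cvg : cvgn s := nondecreasing_is_cvgn s_mono s_ub.
have /cvgrPdist_lt/(_ _ d0) near_lim := s_cvg.
near=> Z => Y.
have [ZY|YZ] := leqP Z Y; last by rewrite big_geq ?(ltnW YZ)// ltW.
have dZ : `|limn s - s Z| < d by near: Z.
have := nondecreasing_cvgn_le s_mono s_cvg Y; rewrite (s_split Z Y ZY).
by have := ler_norm (limn s - s Z); lra.
Unshelve. all: end_near.
Qed.

Lemma limn_einf_gap_eq0 (R : realType) (b : nat -> R) :
  nondecreasing_seq b ->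
  (forall (eps : R) (N : nat), 0 < eps ->
     exists i, (N <= i)%N /\ b i.+1 - b i < eps) ->
  limn_einf (fun i => (b i.+1 - b i)%:E) = 0%E.
Proof.
move=> b_mono gap; rewrite limn_einf_lim.
set u := fun i => (b i.+1 - b i)%:E.
have inf0 n : einfs u n = 0%E.
  apply/eqP; rewrite eq_le; apply/andP; split.
    apply/lee_addgt0Pr => e e0; rewrite add0e.
    have [i [ni ie]] := gap e n e0.
    apply: le_trans (_ : u i <= _)%E; last by rewrite lee_fin ltW.
    by apply: ereal_inf_lbound; exists i.
  apply: le_ereal_inf_tmp => _ [i _ <-].
  by rewrite lee_fin subr_ge0 b_mono.
by rewrite (_ : einfs u = cst 0%E) ?lim_cst//; apply/funext.
Qed.

Section beurling.
Variables (R : realType) (g : nat -> R).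

Lemma beurling_prod_with (e : {fsfun nat -> nat with 0%N}) (i : nat) :
  beurling_prod g [fsfun e with i |-> (e i).+1] = g i * beurling_prod g e.
Proof.
rewrite /beurling_prod finsupp_with/=.
have extend : \prod_(n <- finsupp e) g n ^+ e n =
    \prod_(n <- (i |` finsupp e)%fset) g n ^+ e n.
  apply: big_fset_incl; first exact: fsubsetU1.
  by move=> n _ ne; rewrite fsfun_dflt// expr0.
rewrite extend (big_fsetD1 i) ?fset1U1//= [in RHS](big_fsetD1 i) ?fset1U1//=.
rewrite fsfun_with exprS -mulrA; congr (_ * (_ * _)).
apply: eq_big_seq => n; rewrite !inE => /andP[ni _].
by rewrite fsfun_withE (negbTE ni).
Qed.

Lemma beurling_prod_nat (P : set nat) (ia n : nat) :
  (forall p, P p -> exists2 i, i <> ia & g i = p%:R) -> (0 < n)%N ->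
  (forall p, prime p -> (p %| n)%N -> P p) ->
  exists2 e : {fsfun nat -> nat with 0%N}, beurling_prod g e = n%:R & e ia = 0%N.
Proof.
move=> gP; elim/ltn_ind: n => n IH n0 Pn.
have [n1|n1] := leqP n 1.
  have -> : n = 1%N by lia.
  by exists [fsfun]; rewrite ?fsfunE// /beurling_prod finsupp0 big_seq_fset0.
have pp := pdiv_prime n1; have pn := pdiv_dvd n.
have [i iia gi] := gP _ (Pn _ pp pn).
have [||p pr pdn|e eE e0] := IH (n %/ pdiv n)%N.
- by rewrite ltn_Pdiv// prime_gt1.
- by rewrite divn_gt0 ?prime_gt0// dvdn_leq.
- by apply: Pn => //; exact: dvdn_trans (dvdn_div pn).
exists [fsfun e with i |-> (e i).+1].
  by rewrite beurling_prod_with eE gi -natrM mulnC divnK.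
by rewrite fsfun_withE; case: eqP => // E; case: iia.
Qed.

Lemma beurling_prod_exp (ia k : nat) (e : {fsfun nat -> nat with 0%N}) :
  exists2 e' : {fsfun nat -> nat with 0%N},
    beurling_prod g e' = g ia ^+ k * beurling_prod g e & e' ia = (k + e ia)%N.
Proof.
elim: k => [|k [e' eE e'ia]]; first by exists e; rewrite ?mul1r.
exists [fsfun e' with ia |-> (e' ia).+1].
  by rewrite beurling_prod_with eE exprS mulrA.
by rewrite fsfun_with e'ia.
Qed.

End beurling.

Lemma close_indices_gap (R : realType) (b : nat -> R) (eps : R) (N i j : nat) :
  nondecreasing_seq b -> i != j -> b N + eps < b i -> `|b i - b j| < eps ->
  exists k, (N <= k)%N /\ b k.+1 - b k < eps.
Proof.
move=> b_mono ij bi; rewrite ltr_distlC => /andP[bj1 bj2].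
have above m : b N < b m -> (N <= m)%N.
  by apply: contraTT; rewrite -ltnNge -leNgt => /ltnW; exact: b_mono.
have [lt|gt|E] := ltngtP i j; last by rewrite E eqxx in ij.
  exists i; split; first by apply: above; lra.
  by have := b_mono _ _ lt; lra.
exists j; split; first by apply: above; lra.
by have := b_mono _ _ gt; lra.
Qed.

Theorem theorem1 (R : realType) (P : set nat) (alpha : R) (g b : nat -> R)
    (hP : forall p : nat, P p -> prime p)
    (hsum : (\esum_(p in [set p : nat | prime p /\ ~ P p]) ((p%:R : R)^-1)%:E
               < +oo)%E)
    (halphaZ : alpha \isn't a Num.int)
    (halpha1 : 1 < alpha)
    (hg : enumerates g ([set (p%:R : R) | p in P] `|` [set alpha]))
    (hb : beurling_integers g b) :
  limn_einf (fun i : nat => (b i.+1 - b i)%:E) = 0%E.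
Proof.
case: hg hb => _ [_ _ g_surj] [b_mono [e [e' _ e'K] bE]].
pose Q p := prime p && `[< ~ P p >].
have Q_prime q : Q q -> prime q by case/andP.
have QE : [set p | prime p /\ ~ P p] = [set p | Q p].
  by apply/seteqP; split=> p /=; [move=> [pp /asboolP np]; apply/andP|
     move=> /andP[pp /asboolP np]].
rewrite QE in hsum.
have tailQ d : 0 < d -> \forall Z \near \oo, forall Y,
    \sum_(Z <= q < Y | Q q) (q%:R : R)^-1 <= d by exact: esum_inv_tail.
have [ia _ gia] : exists2 i, [set: nat] i & g i = alpha.
  by have [|i] := g_surj alpha; [right|exists i].
have gP p : P p -> exists2 i, i <> ia & g i = p%:R.
  move=> Pp; have [|i _ gi] := g_surj p%:R; first by left; exists p.
  by exists i => // iE; move: halphaZ; rewrite -gia -iE gi natr_int.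
have Q_free x : (0 < x)%N -> ~~ has Q (divisors x) ->
    forall p, prime p -> (p %| x)%N -> P p.
  move=> x0 /hasPn nQ p pp px; apply: contrapT => nP.
  have := nQ p; rewrite -dvdn_divisors// => /(_ px)/negP; apply.
  by apply/andP; split => //; apply/asboolP.
have pairs (eps : R) T : 0 < eps -> exists x y k,
    [/\ (T < x)%N, (0 < y)%N, ~~ has Q (divisors x), ~~ has Q (divisors y)
      & `|x%:R - alpha ^+ k.+1 * y%:R| < eps].
  move=> eps0; have [rat|irr] := pselect (rational alpha).
    exact: (rational_pairs R Q Q_prime tailQ).
  have [x [y H]] := irrational_pairs R Q Q_prime tailQ alpha eps T halpha1 irr eps0.
  by exists x, y, 0%N; rewrite expr1.
apply: limn_einf_gap_eq0 => // eps N eps0.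
have [x [y [k [xN y0 Qx Qy xy]]]] := pairs eps (Num.trunc (b N + eps)) eps0.
have x0 : (0 < x)%N by exact: leq_ltn_trans xN.
have [e1 e1E e1a] := beurling_prod_nat R g P ia x gP x0 (Q_free x x0 Qx).
have [e0 e0E e0a] := beurling_prod_nat R g P ia y gP y0 (Q_free y y0 Qy).
have [e2 e2E e2a] := beurling_prod_exp R g ia k.+1 e0.
apply: (@close_indices_gap _ _ _ _ (e' e1) (e' e2)) => //.
- apply/negP => /eqP/(can_inj e'K) e12.
  by move: e2a; rewrite -e12 e1a.
- rewrite (bE (e' e1)) e'K e1E (lt_le_trans (truncnS_gt _))//.
  by rewrite ler_nat.
by rewrite !bE !e'K e1E e2E e0E gia.
Qed.
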